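(* Let $V$ be a finite-dimensional $\mathbb{C}$-vector space. If $W \subset \mathrm{GL}(V)$ is an irreducible (finite complex) reflection group, then $W$ admits an irreducible parabolic subgroup of rank $\dim V - 1$.
   Context: A (pseudo-)reflection is an element $s \in \mathrm{GL}(V)$ of finite order such that $\mathrm{Ker}(s-1)$ is a hyperplane of $V$. A finite complex reflection group is a finite subgroup $W \subset \mathrm{GL}(V)$ generated by reflections; it is irreducible if it acts irreducibly on $V$. A parabolic subgroup of $W$ is a nontrivial subgroup $W_0$ which is the fixer (pointwise stabilizer) in $W$ of some linear subspace of $V$; by a theorem of Steinberg it is itself a reflection group in $\mathrm{GL}(V)$. Its rank is the codimension of its fixed space $V^{W_0}$, and $W_0$ is called irreducible if it acts irreducibly on the orthogonal complement of $V^{W_0}$ with respect to a $W$-invariant hermitian scalar product (equivalently, on $V/V^{W_0}$).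
   Formalization: The formal statement assumes dim V ≥ 2; for dim V = 1 the claim fails (e.g. W = {1, −1} on ℂ), since a parabolic subgroup of rank 0 fixes V pointwise and is trivial, while parabolic subgroups are nontrivial by definition. *)

(* Defs.v *)
From mathcomp Require Import all_boot all_order all_algebra.
From mathcomp Require Import finmap reals complex.

Set Implicit Arguments.
Unset Strict Implicit.
Unset Printing Implicit Defensive.

Import GRing.Theory Num.Theory.
Local Open Scope fset_scope.
Local Open Scope ring_scope.

Section ReflectionGroups.

Variables (C : numClosedFieldType) (V : vectType C).

Implicit Types (f g s : 'End(V)) (H S : 'End(V) -> Prop).
Implicit Types (W : {fset 'End(V)}) (U X : {vspace V}).

(* On an injective (hence bijective) endomorphism f, f^-1 is the inverse. *)
Definition is_subgroup_GL H : Prop :=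
  [/\ forall f, H f -> lker f = 0%VS,
      H \1%VF,
      forall f g, H f -> H g -> H (f \o g)%VF
    & forall f, H f -> H (f^-1)%VF].

(* The smallest subgroup of GL(V) containing S is W. *)
Definition is_generated_by W S : Prop :=
  (forall s, S s -> s \in W) /\
  (forall H, is_subgroup_GL H -> (forall s, S s -> H s) ->
     forall g, g \in W -> H g).

Definition is_reflection s : Prop :=
  [/\ lker s = 0%VS,
      exists2 n, (0 < n)%N & iter n s =1 id
    & (\dim (lker (s - \1%VF))).+1 = \dim {:V}].

Definition is_reflection_group W : Prop :=
  is_subgroup_GL (fun g => g \in W) /\
  exists2 S, (forall s, S s -> is_reflection s) & is_generated_by W S.

Definition stable W U : Prop := forall g, g \in W -> (g @: U <= U)%VS.

Definition acts_irreducibly W U : Prop :=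
  [/\ U <> 0%VS,
      stable W U
    & forall X, (X <= U)%VS -> stable W X -> X = 0%VS \/ X = U].

Definition fixer W U : {fset 'End(V)} :=
  [fset g in W | (U <= fixedSpace g)%VS].

Definition fixed_space W : {vspace V} := (\bigcap_(g <- W) fixedSpace g)%VS.

Definition rank W : nat := (\dim {:V} - \dim (fixed_space W))%N.

Definition is_parabolic W W0 : Prop :=
  W0 <> [fset \1%VF] /\ exists U, W0 = fixer W U.

Definition invariant_form W (h : {dot V for Num.conj}) : Prop :=
  forall g, g \in W -> forall u v, h (g u) (g v) = h u v.

Definition is_irreducible_parabolic W W0 : Prop :=
  is_parabolic W W0 /\
  exists2 h : {dot V for Num.conj}, invariant_form W h
    & acts_irreducibly W0 (orthov h (fixed_space W0)).

End ReflectionGroups.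

(* Main.v *)
Require Import Defs.
From HB Require Import structures.
From mathcomp Require Import all_boot all_order all_algebra.
From mathcomp Require Import finmap reals complex.

(** Fix a [W]-invariant hermitian form. By irreducibility, for every proper
    nonzero subspace [U] some reflection of [W] has its root line neither in [U]
    nor orthogonal to [U]. Starting from one root line and adding such lines one
    at a time gives, in each dimension [k] with [0 < k < dim V], a subspace [U]
    whose orthogonal complement has in [W] a fixer that acts irreducibly on [U]
    and has no other fixed vectors. Take [k = dim V - 1]. Steinberg's theorem is
    not needed, since only irreducibility of the fixer is used, not that it is
    generated by reflections. *)

Set Implicit Arguments.
Unset Strict Implicit.
Unset Printing Implicit Defensive.

Import Order.TTheory GRing.Theory Num.Theory.
Local Open Scope ring_scope.

(** * Fixed vectors and stabilizers of subspaces *)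

Lemma mem_fixed_space (C : numClosedFieldType) (V : vectType C)
    (W : {fset 'End(V)}) (x : V) :
  reflect (forall g, g \in W -> g x = x) (x \in fixed_space W).
Proof.
suff -> : x \in fixed_space W = all (fun g : 'End(V) => g x == x) W.
  by apply: (iffP allP) => fix_x g /fix_x /eqP.
rewrite /fixed_space; elim: (W : seq _) => [|g r IHr].
  by rewrite big_nil memvf.
by rewrite big_cons memv_cap IHr /=; congr (_ && _); apply/fixedSpaceP/eqP.
Qed.

(** This lets the minimality in [is_generated_by] pass stability of [U] from the generating
    reflections to all of [W]. Inverses preserve [U] because an injective [g] with [g @: U <= U] has
    [g @: U = U] by dimension. *)
Lemma stabilizer_subgroup_GL (C : numClosedFieldType) (V : vectType C)
    (U : {vspace V}) :
  is_subgroup_GL (fun g : 'End(V) => lker g = 0%VS /\ (g @: U <= U)%VS).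
Proof.
split=> [g [] //||f g [kf fU] [kg gU]|g [kg gU]].
- by split; [apply/eqP/lker0P => x y; rewrite !id_lfunE | rewrite lim1g subvv].
- have inj_f : injective f by exact/lker0P/eqP.
  have inj_g : injective g by exact/lker0P/eqP.
  split; first by apply/eqP/lker0P => x y; rewrite !comp_lfunE => /inj_f/inj_g.
  by rewrite limg_comp (subv_trans (limgS f gU)).
- have kg0 : lker g == 0%VS by apply/eqP.
  split; first by apply/eqP/lker0P; apply: can_inj (lker0_lfunVK kg0).
  rewrite -(limg_ker0 _ _ kg0) -limg_comp lker0_compfV // lim1g.
  suff /eqP -> : (g @: U == U)%VS by rewrite subvv.
  by rewrite eqEdim gU limg_dim_eq ?kg ?capv0 /=.
Qed.

Section OrthogonalComplement.

Variables (C : numClosedFieldType) (V : vectType C) (h : {dot V for Num.conj}).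

Implicit Types (U : {vspace V}).

Lemma cap_orthov U : (U :&: orthov h U = 0)%VS.
Proof.
apply/eqP; rewrite -subv0; apply/subvP => x /memv_capP[xU /mem_orthovP/(_ x xU)].
by rewrite memv0 -(dnorm_eq0 h) => ->.
Qed.

Lemma add_orthov U : (U + orthov h U = fullv)%VS.
Proof.
apply/eqP; rewrite eqEsubv subvf; apply/subvP => x _.
have [y yU [z [-> _ zU]]] := orthogonal_split h (vbasis U) x.
rewrite (span_basis (vbasisP U)) in yU.
apply: memv_add yU _; move: zU; rewrite orthogonalE span_seq1.
by rewrite (span_basis (vbasisP U)).
Qed.

Lemma dim_orthov U : (\dim U + \dim (orthov h U))%N = \dim {:V}.
Proof. by rewrite -(add_orthov U) dimv_disjoint_sum ?cap_orthov. Qed.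

Lemma orthovK U : orthov h (orthov h U) = U.
Proof.
apply/esym/eqP; rewrite eqEdim orthov_sym subvv /=.
by have := dim_orthov (orthov h U); rewrite -(dim_orthov U) addnC => /addIn->.
Qed.

Lemma orthov_add U1 U2 : orthov h (U1 + U2) = (orthov h U1 :&: orthov h U2)%VS.
Proof.
apply/vspaceP => x; rewrite memv_cap !mem_orthov_sym.
by rewrite subv_add.
Qed.

End OrthogonalComplement.

(** * Invariant form by averaging over the group *)

Section InvariantForm.

Variables (C : numClosedFieldType) (V : vectType C) (W : {fset 'End(V)}).

(** The standard hermitian product in a fixed basis, summed over [W] without dividing by its
    order. *)
Definition averaged_form (u v : V) : C :=
  \sum_(g <- W) \sum_i coord (vbasis fullv) i (g u)
                       * (coord (vbasis fullv) i (g v))^*.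

Lemma averaged_form_bilinear :
  bilinear_for (GRing.Scale.Law.clone _ _ *%R _)
    (GRing.Scale.Law.clone _ _ (Num.conj \; *%R) _) averaged_form.
Proof.
split=> [v | u] a x y /=; rewrite /averaged_form mulr_sumr -big_split /=;
  apply: eq_bigr => g _; rewrite mulr_sumr -big_split /=;
  apply: eq_bigr => i _; rewrite !linearP /=.
- by rewrite mulrDl mulrA.
- by rewrite rmorphD rmorphM mulrDr mulrCA.
Qed.

HB.instance Definition _ :=
  bilinear_isBilinear.Build C V V C (GRing.Scale.Law.clone _ _ *%R _)
    (GRing.Scale.Law.clone _ _ (Num.conj \; *%R) _)
    averaged_form averaged_form_bilinear.

Lemma averaged_form_hermitian (u v : V) :
  averaged_form u v = (-1) ^+ false * (averaged_form v u)^*.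
Proof.
rewrite mul1r rmorph_sum; apply: eq_bigr => g _; rewrite rmorph_sum.
by apply: eq_bigr => i _; rewrite rmorphM /= conjCK mulrC.
Qed.

HB.instance Definition _ :=
  isHermitianSesquilinear.Build C V false Num.conj
    averaged_form averaged_form_hermitian.

Hypothesis W_group : is_subgroup_GL (fun g => g \in W).

Lemma averaged_form_definite (u : V) : u != 0 -> 0 < averaged_form u u.
Proof.
move=> u_neq0; have [_ W1 _ _] := W_group.
have coord_ge0 w i : 0 <= coord (vbasis {:V}) i w * (coord (vbasis fullv) i w)^*.
  exact: mul_conjC_ge0.
have sum_ge0 (w : V) :
    0 <= \sum_i coord (vbasis fullv) i w * (coord (vbasis fullv) i w)^*.
  exact: sumr_ge0.
(* The identity contributes a strictly positive term, and all other terms are nonnegative. *)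
rewrite /averaged_form (big_rem _ W1) /=.
apply: ltr_wpDr; first by apply: sumr_ge0.
rewrite id_lfunE lt_def sum_ge0 andbT.
apply: contra u_neq0; rewrite psumr_eq0 // => /allP coord0.
rewrite (coord_vbasis (memvf u)) big1 // => i _.
have := coord0 i (mem_index_enum i); rewrite mul_conjC_eq0 => /eqP ->.
by rewrite scale0r.
Qed.

(** Right translation by [g] permutes [W], so it only reorders the sum. *)
Lemma averaged_form_invariant g : g \in W ->
  forall u v, averaged_form (g u) (g v) = averaged_form u v.
Proof.
move=> Wg u v; have [inj_W _ WM WV] := W_group.
have ker_g : lker g == 0%VS by rewrite inj_W.
pose F (k : 'End(V)) := \sum_i coord (vbasis fullv) i (k u)
                   * (coord (vbasis fullv) i (k v))^*.
have -> : averaged_form (g u) (g v) = \sum_(k <- [seq (k \o g)%VF | k <- W]) F k.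
  rewrite big_map; apply: eq_bigr => k _; apply: eq_bigr => i _.
  by rewrite !comp_lfunE.
apply: perm_big; apply: uniq_perm; rewrite ?fset_uniq //.
  rewrite map_inj_uniq ?fset_uniq // => k1 k2.
  by move=> /(congr1 (fun k => (k \o g^-1)%VF)); rewrite !lker0_compfK.
move=> k; apply/mapP/idP => [[k' Wk' ->] | Wk]; first exact: WM.
by exists (k \o g^-1)%VF; rewrite ?lker0_compfVK //; apply: WM => //; apply: WV.
Qed.

Lemma exists_invariant_form : exists h : {dot V for Num.conj}, invariant_form W h.
Proof.
pose D := isDotProduct.Build C V averaged_form averaged_form_definite.
pose h : {dot V for Num.conj} := HB.pack averaged_form D.
exists h; exact: averaged_form_invariant.
Qed.

End InvariantForm.

(** * Subspaces on which a fixer acts irreducibly *)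

Section Blocks.

Variables (C : numClosedFieldType) (V : vectType C) (W : {fset 'End(V)}).
Variables (h : {dot V for Num.conj}).
Hypothesis h_inv : invariant_form W h.

Implicit Types (U X L : {vspace V}) (s g : 'End(V)).

(** For [y] orthogonal to [U], [g y = y], so invariance gives [h (g x) y = h (g x) (g y) = h x y].
    Thus [g x - x] lies in the double complement of [U]. *)
Lemma displacement g U x :
  g \in W -> (orthov h U <= fixedSpace g)%VS -> g x - x \in U.
Proof.
move=> Wg /fixedSpacesP fix_g; rewrite -(orthovK h U); apply/mem_orthovP => y Uy.
by rewrite linearBl /= -{1}(fix_g y Uy) h_inv // subrr.
Qed.

Lemma mem_fixer g U :
  (g \in fixer W U) = (g \in W) && (U <= fixedSpace g)%VS.
Proof. by rewrite !inE. Qed.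

Lemma stable_fixer_orthov U : stable (fixer W (orthov h U)) U.
Proof.
move=> g; rewrite mem_fixer => /andP[Wg fix_g]; apply/subvP => _ /memv_imgP[x Ux ->].
by rewrite -(subrK x (g x)) memvD ?displacement.
Qed.

(* For a reflection [s] this is the line spanned by its root, i.e. the image of
   [s - 1]. *)
Definition root_line s : {vspace V} := orthov h (fixedSpace s).

Lemma orthov_root_line s : orthov h (root_line s) = fixedSpace s.
Proof. exact: orthovK. Qed.

Lemma dim_root_line s :
  (\dim (fixedSpace s)).+1 = \dim {:V} -> \dim (root_line s) = 1%N.
Proof. by rewrite -(dim_orthov h (fixedSpace s)) -addn1 => /addnI. Qed.

(** If some [x] in [X] is moved by [s], then [s x - x] is a nonzero vector of [X] and spans the root
    line. *)
Lemma stable_reflection s X :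
    s \in W -> (\dim (fixedSpace s)).+1 = \dim {:V} -> (s @: X <= X)%VS ->
  (X <= fixedSpace s)%VS \/ (root_line s <= X)%VS.
Proof.
move=> Ws /dim_root_line dimL sX.
have [|/subvPn[x Xx fix'x]] := boolP (X <= fixedSpace s)%VS; [by left | right].
pose d := s x - x.
have d_neq0 : d != 0 by apply: contra fix'x; rewrite subr_eq0 => /eqP/fixedSpaceP.
have Ld : (<[d]> <= root_line s)%VS.
  by rewrite -memvE displacement ?orthov_root_line ?subvv.
have /eqP <- : <[d]>%VS == root_line s by rewrite eqEdim Ld dimL dim_vline d_neq0.
by rewrite -memvE memvB // (subvP sX) ?memv_img.
Qed.

(** The second clause excludes a trivial fixer, which would act irreducibly on a line, and makes the
    rank of the fixer equal to [\dim U]. *)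
Definition block U : Prop :=
  acts_irreducibly (fixer W (orthov h U)) U /\
  fixed_space (fixer W (orthov h U)) = orthov h U.

Lemma sub_orthov_fixed_space U :
  (orthov h U <= fixed_space (fixer W (orthov h U)))%VS.
Proof.
apply/subvP => x Ux; apply/mem_fixed_space => g; rewrite mem_fixer.
by case/andP=> _ /fixedSpacesP ->.
Qed.

Lemma block_root_line s :
    s \in W -> (\dim (fixedSpace s)).+1 = \dim {:V} -> block (root_line s).
Proof.
move=> Ws dim_fix; have dimL := dim_root_line dim_fix.
split; last first.
  apply/eqP; rewrite eqEsubv sub_orthov_fixed_space andbT orthov_root_line.
  apply/subvP => x /mem_fixed_space fix_x; apply/fixedSpaceP/fix_x.
  by rewrite mem_fixer Ws subvv.
split=> [L0||X XL _]; [by rewrite L0 dimv0 in dimL | exact: stable_fixer_orthov |].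
have [->|X_neq0] := eqVneq X 0%VS; [by left | right].
by apply/eqP; rewrite eqEdim XL dimL lt0n dimv_eq0.
Qed.

(** By irreducibility [X :&: U] is [U] or zero. In the latter case each [g x - x] with [x] in [X]
    lies in [X :&: U], hence vanishes, so the fixer fixes [X] pointwise. *)
Lemma stable_block U X :
    block U -> stable (fixer W (orthov h U)) X ->
  (U <= X)%VS \/ (X <= orthov h U)%VS.
Proof.
move=> [[_ stU irrU] fixU] stX.
have stXU : stable (fixer W (orthov h U)) (X :&: U)%VS.
  move=> g Wg; apply: subv_trans (limg_cap _ _ _) _.
  by apply: capvS; [exact: stX | exact: stU].
have [XU0 | <-] := irrU _ (capvSr X U) stXU; [right | by left; exact: capvSl].
rewrite -fixU; apply/subvP => x Xx; apply/mem_fixed_space => g Wg.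
apply/eqP; rewrite -subr_eq0 -memv0 -XU0 memv_cap memvB //=; last first.
  by rewrite (subvP (stX g Wg)) ?memv_img.
by move: Wg; rewrite mem_fixer => /andP[Ww fix_g]; apply: displacement.
Qed.

(** The new fixer contains both the old one and [s], so a subspace stable under it obeys both
    [stable_block] and [stable_reflection]. *)
Lemma block_add_root_line U s :
    s \in W -> (\dim (fixedSpace s)).+1 = \dim {:V} ->
    ~~ (root_line s <= U)%VS -> ~~ (root_line s <= orthov h U)%VS ->
  block U -> block (U + root_line s) /\ \dim (U + root_line s) = (\dim U).+1.
Proof.
move=> Ws dim_fix notLU notLU' blockU; have dimL := dim_root_line dim_fix.
set U' := (U + root_line s)%VS; split; last first.
  rewrite dimv_disjoint_sum ?dimL ?addn1 //; apply/eqP.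
  apply: contraR notLU => UL_neq0; suff /eqP <- : (U :&: root_line s == root_line s)%VS.
    exact: capvSl.
  by rewrite eqEdim capvSr dimL lt0n dimv_eq0.
have orthU' : orthov h U' = (orthov h U :&: fixedSpace s)%VS.
  by rewrite orthov_add orthov_root_line.
have Ws' : s \in fixer W (orthov h U') by rewrite mem_fixer Ws orthU' capvSr.
have subW g : g \in fixer W (orthov h U) -> g \in fixer W (orthov h U').
  rewrite !mem_fixer => /andP[-> fix_g].
  by rewrite orthU' (subv_trans (capvSl _ _) fix_g).
split; last first.
  apply/eqP; rewrite eqEsubv sub_orthov_fixed_space andbT {2}orthU' subv_cap -blockU.2.
  apply/andP; split; apply/subvP => x /mem_fixed_space fix_x.
    by apply/mem_fixed_space => g /subW; apply: fix_x.
  exact/fixedSpaceP/fix_x.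
split=> [U'0||X XU' stX].
- by case/negP: notLU; rewrite (subv_trans (addvSr U _)) // -/U' U'0 sub0v.
- exact: stable_fixer_orthov.
have stXU : stable (fixer W (orthov h U)) X by move=> g /subW; apply: stX.
(* Of the four combinations, the two mixed ones, [U <= X <= fixedSpace s] and
   [root_line s <= X <= orthov h U], would make the root line orthogonal to [U]. The others give
   [X = 0] and [X = U']. *)
case: (stable_reflection Ws dim_fix (stX s Ws')) => [X_fix | LX];
  case: (stable_block blockU stXU) => [UX | XU].
- by case/negP: notLU'; rewrite orthov_sym orthov_root_line (subv_trans UX).
- left; apply/eqP; rewrite -subv0 -(cap_orthov h U') subv_cap XU' orthU'.
  by rewrite subv_cap XU.
- by right; apply/eqP; rewrite eqEsubv XU' subv_add UX.
- by case/negP: notLU'; apply: subv_trans XU.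
Qed.

(** Otherwise every reflection of the generating set would stabilize [U]: it moves vectors by
    elements of its root line if that lies in [U], and fixes [U] pointwise if that is orthogonal to
    [U]. *)
Lemma exists_root_line U :
    is_reflection_group W -> acts_irreducibly W fullv ->
    (0 < \dim U < \dim {:V})%N ->
  exists s, [/\ s \in W, (\dim (fixedSpace s)).+1 = \dim {:V},
    ~~ (root_line s <= U)%VS & ~~ (root_line s <= orthov h U)%VS].
Proof.
move=> [[inj_W _ _ _] [S reflS [SW genS]]] [_ _ irrW] /andP[U_gt0 U_lt].
pose good (s : 'End(V)) := [&& (\dim (fixedSpace s)).+1 == \dim {:V},
  ~~ (root_line s <= U)%VS & ~~ (root_line s <= orthov h U)%VS].
have [/hasP[s Ws /and3P[/eqP]] | /hasPn noW] := boolP (has good W).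
  by exists s.
have stU : stable W U.
  suff WH : forall g, g \in W -> lker g = 0%VS /\ (g @: U <= U)%VS.
    by move=> g /WH[].
  apply: genS => [|s Ss].
    exact: stabilizer_subgroup_GL.
  have [ks _ dim_fix] := reflS s Ss; split=> //.
  have := noW s (SW s Ss); rewrite /good dim_fix eqxx /= negb_and !negbK.
  case/orP=> [LU | LU']; last first.
    by rewrite fixedSpace_limg ?subvv // -orthov_root_line orthov_sym.
  apply/subvP => _ /memv_imgP[x Ux ->]; rewrite -(subrK x (s x)) memvD //.
  by apply: (subvP LU); rewrite displacement ?orthov_root_line ?SW.
have [U0 | Ufull] := irrW U (subvf U) stU.
  by rewrite U0 dimv0 in U_gt0.
by rewrite Ufull ltnn in U_lt.
Qed.

Lemma exists_block k :
    is_reflection_group W -> acts_irreducibly W fullv ->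
    (0 < k < \dim {:V})%N ->
  exists2 U, block U & \dim U = k.
Proof.
move=> reflW irrW; elim: k => // -[_ V_gt1 | k IHk V_gt].
  (* Any line will do: it is proper since [\dim {:V} > 1], and it only serves to produce one
     reflection in [W]. *)
  pose v := vpick {:V}.
  have v_neq0 : v != 0 by rewrite vpick0 -dimv_eq0 -lt0n ltnW.
  have [|s [Ws dim_fix _ _]] := @exists_root_line <[v]> reflW irrW.
    by rewrite dim_vline v_neq0.
  by exists (root_line s); [exact: block_root_line | exact: dim_root_line].
have [|U blockU dimU] := IHk; first exact: ltnW.
have [|s [Ws dim_fix LU LU']] := @exists_root_line U reflW irrW.
  by rewrite dimU; exact: ltnW.
have [? dimU'] := block_add_root_line Ws dim_fix LU LU' blockU.
by exists (U + root_line s)%VS; rewrite // dimU' dimU.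
Qed.

End Blocks.

(* If dim V = 1, a parabolic subgroup of rank 0 would fix V pointwise, hence
   be trivial; parabolic subgroups being nontrivial, dim V >= 2 is required. *)
Theorem corollary3p2 (R : realType) (V : vectType R[i]) (W : {fset 'End(V)})
    (dimV : (1 < \dim {:V})%N)
    (reflW : is_reflection_group W)
    (irrW : acts_irreducibly W fullv) :
  exists W0 : {fset 'End(V)},
    is_irreducible_parabolic W W0 /\ rank W0 = (\dim {:V} - 1)%N.
Proof.
have [h h_inv] := exists_invariant_form reflW.1.
have [|U [irrU fixU] dimU] :=
  exists_block (k := (\dim {:V} - 1)%N) h_inv reflW irrW.
  by rewrite subn_gt0 dimV subn1 ltn_predL ltnW.
have dimUU := dim_orthov h U.
exists (fixer W (orthov h U)); split; last first.
  by rewrite /rank fixU -[in LHS]dimUU addnK.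
split; last by exists h; rewrite // fixU orthovK.
split; last by exists (orthov h U).
(* A trivial fixer would fix all of [V], and comparing dimensions would force
   [\dim U = \dim {:V} - 1] to be zero. *)
move=> W0_triv; have : \dim (fixed_space (fixer W (orthov h U))) = \dim {:V}.
  congr (\dim _); apply/eqP; rewrite eqEsubv subvf; apply/subvP => x _.
  by apply/mem_fixed_space => g; rewrite W0_triv inE => /eqP ->; rewrite id_lfunE.
rewrite fixU -dimUU dimU => /eqP; rewrite -{1}[\dim (orthov h U)]add0n.
by rewrite eqn_add2r eq_sym subn_eq0 leqNgt dimV.
Qed.
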